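(* Fix $t>0$. Let $\{\alpha_k\}_{k\in\mathbb{N}}$ be real numbers none of which is a natural number, such that for all $k,m\in\mathbb{N}$ with $\alpha_k\neq\alpha_m$, $$\Gamma\!\left(-\tfrac{\alpha_m}{2}\right)\Gamma\!\left(\tfrac{1-\alpha_k}{2}\right)=\Gamma\!\left(-\tfrac{\alpha_k}{2}\right)\Gamma\!\left(\tfrac{1-\alpha_m}{2}\right).$$ Then the functions $\{\mathcal{H}_{\alpha_k}(x,t)\}_{k\in\mathbb{N}}$ form an orthogonal set on the interval $(0,\infty)$ with weight function $e^{-\frac{x^2}{2t}}$, i.e. $\int_0^\infty \mathcal{H}_{\alpha_k}(x,t)\mathcal{H}_{\alpha_m}(x,t)e^{-\frac{x^2}{2t}}\,dx=0$ whenever $\alpha_k\neq\alpha_m$.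
   Context: $U(a,z)$ denotes the standard (Whittaker) parabolic cylinder function (Abramowitz–Stegun, Ch. 19), and $D_\nu(z)=U(-\nu-\tfrac12,z)$. For $\alpha\in\mathbb{R}$, $t>0$, $x\in\mathbb{R}$, the power-normalised parabolic cylinder function is $$\mathcal{H}_\alpha(x,t)=t^{\frac{\alpha}{2}}e^{\frac{x^2}{4t}}D_\alpha\!\left(\tfrac{x}{\sqrt t}\right)=t^{\frac{\alpha}{2}}e^{\frac{x^2}{4t}}U\!\left(-\alpha-\tfrac12,\tfrac{x}{\sqrt t}\right).$$ *)

(* Defs.v *)
From Stdlib Require Import Reals.
From Coquelicot Require Import Coquelicot.
Open Scope R_scope.

(* Reciprocal Gamma function 1/Gamma, an entire function, via the Gauss
   product limit:  1/Gamma(x) = lim_n  x(x+1)...(x+n) / (n! n^x).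
   It vanishes exactly at the poles 0,-1,-2,... of Gamma. *)
Definition rgamma (x : R) : R :=
  real (Lim_seq (fun n : nat =>
    prod_f_R0 (fun j => x + INR j) n / (INR (Factorial.fact n) * Rpower (INR n) x))).

(* Euler's Gamma function (at non-poles), Gamma x = 1 / rgamma x. *)
Definition Gamma (x : R) : R := / rgamma x.

Fixpoint poch (a : R) (n : nat) : R :=
  match n with
  | O => 1
  | S m => poch a m * (a + INR m)
  end.

Definition kummerM (a b x : R) : R :=
  Series (fun n : nat => poch a n / (poch b n * INR (Factorial.fact n)) * x ^ n).

(* Whittaker's parabolic cylinder function U(a,z) (A&S 19.3, DLMF 12.4.1,
   12.2.6-7, 12.7.12-13):
   U(a,z) = U(a,0) e^{-z^2/4} M(a/2+1/4,1/2,z^2/2)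
          + U'(a,0) z e^{-z^2/4} M(a/2+3/4,3/2,z^2/2),
   U(a,0) = sqrt(pi) / (2^{a/2+1/4} Gamma(3/4+a/2)),
   U'(a,0) = - sqrt(pi) / (2^{a/2-1/4} Gamma(1/4+a/2)). *)
Definition pcfU (a z : R) : R :=
  sqrt PI / Rpower 2 (a / 2 + / 4) * rgamma (3 / 4 + a / 2)
    * exp (- z ^ 2 / 4) * kummerM (a / 2 + / 4) (/ 2) (z ^ 2 / 2)
  - sqrt PI / Rpower 2 (a / 2 - / 4) * rgamma (/ 4 + a / 2)
    * z * exp (- z ^ 2 / 4) * kummerM (a / 2 + 3 / 4) (3 / 2) (z ^ 2 / 2).

Definition pcfD (nu z : R) : R := pcfU (- nu - / 2) z.

Definition pcfH (alpha x t : R) : R :=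
  Rpower t (alpha / 2) * exp (x ^ 2 / (4 * t)) * pcfD alpha (x / sqrt t).

(* Main.v *)
Require Import Defs.
From Stdlib Require Import Reals Lra Lia.
From Coquelicot Require Import Coquelicot.
Open Scope R_scope.

(* [D = pcfD nu] solves [D'' = (z ^ 2 / 4 - nu - 1 / 2) D], so the Wronskian of [D_mu] and
   [D_nu] is a primitive of [(mu - nu) D_mu D_nu]. It vanishes at [0] by the Gamma condition,
   and at infinity because [D] and [D'] tend to [0].

   The decay is obtained from the Taylor coefficients [c_m] of [exp (z ^ 2 / 4) D]. They
   eventually alternate in sign, and Gauss' limit for [1 / Gamma] gives
   [c_(m+1)^2 ~ c_m c_(m+2)]; by AM-GM the even and odd parts cancel to leading order, so [D]
   is negligible against the even solution of the same equation. A solution [y] with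
   [y y' > 0] at some large point dominates every other solution; hence [D D' <= 0] near
   infinity, which makes [D ^ 2 + D' ^ 2] decrease to [0]. *)

(** * Gauss' limit for the reciprocal Gamma function *)

(** Both bounds come from ln v <= v - 1, taken at 1 + u and at 1 / (1 + u); the condition on u gives
    1 / (1 + u) <= 2. *)
Lemma ln_1p_bounds (u : R) :
  Rabs u <= / 2 -> u - 2 * u ^ 2 <= ln (1 + u) <= u.
Proof.
  intros Hu; apply Rabs_le_between in Hu.
  assert (H : forall v, 0 < v -> ln v <= v - 1).
  { intros v Hv. rewrite <- (exp_ln v) at 2 by exact Hv.
    generalize (exp_ineq1_le (ln v)); lra. }
  split.
  - assert (H1 := H (/ (1 + u)) (Rinv_0_lt_compat (1 + u) ltac:(lra))).
    rewrite ln_Rinv in H1 by lra.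
    assert (H2 : / (1 + u) - 1 = - u + u ^ 2 * / (1 + u)) by (field; lra).
    assert (H3 : / (1 + u) <= / / 2) by (apply Rinv_le_contravar; lra).
    rewrite Rinv_inv in H3.
    assert (0 <= u ^ 2) by nra.
    nra.
  - generalize (H (1 + u) ltac:(lra)); lra.
Qed.

(** Both [v] and [u + v] are nonincreasing and bounded below, hence convergent, and [u] is their
    difference. *)
Lemma ex_finite_lim_seq_telescope (u v : nat -> R) :
  (forall n, Rabs (u (S n) - u n) <= v n - v (S n)) -> (forall n, 0 <= v n) ->
  ex_finite_lim_seq u.
Proof.
  intros Huv Hv.
  assert (H : forall n, - (v n - v (S n)) <= u (S n) - u n <= v n - v (S n)).
  { intros n; apply Rabs_le_between, Huv. }
  assert (Hm : forall n, u 0%nat - v 0%nat <= u n - v n).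
  { induction n as [|n IH]; [lra|]. generalize (H n); lra. }
  destruct (ex_finite_lim_seq_decr (fun n => u n + v n) (u 0%nat - v 0%nat)) as [l1 H1].
  { intros n; generalize (H n); lra. }
  { intros n; generalize (Hm n) (Hv n); lra. }
  destruct (ex_finite_lim_seq_decr v 0) as [l2 H2].
  { intros n; generalize (H n); lra. }
  { exact Hv. }
  exists (l1 - l2).
  apply is_lim_seq_ext with (fun n => (u n + v n) - v n); [intros; ring|].
  now apply is_lim_seq_minus'.
Qed.

Definition gauss (x : R) (n : nat) : R :=
  prod_f_R0 (fun j => x + INR j) n / (INR (Factorial.fact n) * Rpower (INR n) x).

(** In the exponent the first-order terms x / (n + 1) and - x / (n + 1) cancel, which leaves a
    summable O(1 / n ^ 2). The hypotheses keep the arguments of the logarithms positive. *)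
Lemma gauss_succ (x : R) (n : nat) :
  (1 <= n)%nat -> Rabs x / INR (S n) <= / 2 ->
  gauss x (S n) = gauss x n * exp (ln (1 + x / INR (S n)) + x * ln (1 + - / INR (S n))).
Proof.
  intros Hn Hx.
  assert (Hn0 : 1 <= INR n) by (apply (le_INR 1); exact Hn).
  assert (HS : INR (S n) = INR n + 1) by apply S_INR.
  assert (Hpos : 0 < 1 + x / INR (S n)).
  { assert (Hab : Rabs (x / INR (S n)) <= / 2).
    { rewrite Rabs_div by lra. rewrite (Rabs_pos_eq (INR (S n))) by lra. exact Hx. }
    apply Rabs_le_between in Hab. lra. }
  rewrite exp_plus, exp_ln by exact Hpos.
  replace (1 + - / INR (S n)) with (INR n / INR (S n)) by (rewrite HS; field; lra).
  rewrite ln_div by lra.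
  rewrite Rmult_minus_distr_l, <- (Rplus_0_r (x * ln (INR n) - _)).
  unfold gauss, Rpower.
  rewrite Rplus_0_r. unfold Rminus at 1. rewrite exp_plus, exp_Ropp.
  rewrite fact_simpl, mult_INR. cbn [prod_f_R0].
  field. repeat split; try (apply Rgt_not_eq, exp_pos); try lra.
  apply INR_fact_neq_0.
Qed.

(** From index [N] on, the sequence is [gauss x N] times the exponential of a convergent sum;
    neither factor of the limit vanishes. *)
Lemma gauss_cv (x : R) : (forall n, x + INR n <> 0) ->
  exists l, l <> 0 /\ is_lim_seq (gauss x) l.
Proof.
  intros Hx.
  destruct (nfloor_ex (2 * Rabs x + 2)) as [N0 [HN1 HN2]].
  { generalize (Rabs_pos x); lra. }
  set (N := S N0).
  assert (HN : 2 * Rabs x + 2 < INR N) by (unfold N; rewrite S_INR; lra).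
  assert (Hax := Rabs_pos x).
  assert (HNn : forall n, INR N <= INR (N + n)) by (intros; apply le_INR; lia).
  set (d := fun n => ln (1 + x / INR (S (N + n))) + x * ln (1 + - / INR (S (N + n)))).
  assert (Hstep : forall n, gauss x (N + S n) = gauss x (N + n) * exp (d n)).
  { intros n. rewrite Nat.add_succ_r. apply gauss_succ; [unfold N; lia|].
    rewrite S_INR. generalize (HNn n); intros.
    apply Rmult_le_reg_r with (INR (N + n) + 1); [lra|].
    unfold Rdiv. rewrite Rmult_assoc, Rinv_l; lra. }
  (* With h = 1 / (m + 1), both logarithms have error at most a multiple of h ^ 2, and h ^ 2 <= h /
     m = 1 / m - h telescopes. *)
  assert (Hd : forall n, Rabs (d n) <= (2 * x ^ 2 + 2 * Rabs x) * / INR (N + n)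
                                       - (2 * x ^ 2 + 2 * Rabs x) * / INR (N + S n)).
  { intros n. unfold d. rewrite Nat.add_succ_r, S_INR.
    generalize (HNn n); intros Hn. set (m := INR (N + n)) in *.
    set (h := / (m + 1)).
    assert (Hh : 0 < h) by (apply Rinv_0_lt_compat; lra).
    assert (Hhm : h * (m + 1) = 1) by (apply Rinv_l; lra).
    assert (E : / m - h = h * / m) by (unfold h; field; lra).
    assert (Hhm' : h <= / m) by (apply Rinv_le_contravar; lra).
    assert (h <= / 2) by (apply Rinv_le_contravar; lra).
    assert (Hxh : Rabs (x * h) <= / 2).
    { rewrite Rabs_mult, (Rabs_pos_eq h) by lra. nra. }
    assert (H1 := ln_1p_bounds (x * h) Hxh).
    assert (H2 := ln_1p_bounds (- h)
       ltac:(rewrite Rabs_Ropp, Rabs_pos_eq; lra)).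
    unfold Rdiv. fold h. rewrite <- Rmult_minus_distr_l, E.
    assert (Hq : h * h <= h * / m) by (apply Rmult_le_compat_l; lra).
    apply Rle_trans with ((2 * x ^ 2 + 2 * Rabs x) * (h * h)).
    2:{ apply Rmult_le_compat_l; [nra|exact Hq]. }
    set (l1 := ln (1 + x * h)) in *. set (l2 := ln (1 + - h)) in *.
    replace (l1 + x * l2) with ((l1 - x * h) + x * (l2 + h)) by ring.
    eapply Rle_trans; [apply Rabs_triang|].
    rewrite Rabs_mult.
    assert (Rabs (l1 - x * h) <= 2 * (x * h) ^ 2) by (apply Rabs_le_between; split; nra).
    assert (Rabs (l2 + h) <= 2 * h ^ 2) by (apply Rabs_le_between; split; nra).
    assert (Rabs x * Rabs (l2 + h) <= Rabs x * (2 * h ^ 2)) by (apply Rmult_le_compat_l; lra).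
    nra. }
  set (u := fun n => match n with O => 0 | S k => sum_f_R0 d k end).
  assert (Hu : forall n, u (S n) - u n = d n).
  { intros [|n]; simpl; ring. }
  destruct (ex_finite_lim_seq_telescope u
              (fun n => (2 * x ^ 2 + 2 * Rabs x) * / INR (N + n))) as [L HL].
  { intros n. rewrite Hu. apply Hd. }
  { intros n. apply Rmult_le_pos; [nra|].
    left; apply Rinv_0_lt_compat. generalize (HNn n); lra. }
  assert (Hg : forall n, gauss x (N + n) = gauss x N * exp (u n)).
  { induction n as [|n IH].
    - rewrite Nat.add_0_r. simpl. rewrite exp_0; ring.
    - rewrite Hstep, IH, <- Hu.
      replace (u (S n)) with (u n + (u (S n) - u n)) at 2 by ring.
      rewrite exp_plus; ring. }
  exists (gauss x N * exp L). split.
  - apply Rmult_integral_contrapositive_currified; [|apply Rgt_not_eq, exp_pos].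
    unfold gauss, Rdiv. apply Rmult_integral_contrapositive_currified.
    + clear - Hx. generalize N; clear N; intros N. induction N as [|n IH]; cbn [prod_f_R0]; [apply Hx|].
      apply Rmult_integral_contrapositive_currified; [exact IH|apply Hx].
    + apply Rinv_neq_0_compat, Rmult_integral_contrapositive_currified.
      * apply INR_fact_neq_0.
      * apply Rgt_not_eq, exp_pos.
  - apply (is_lim_seq_incr_n _ N).
    apply is_lim_seq_ext with (fun n => gauss x N * exp (u n)).
    { intros n. rewrite <- Hg. f_equal. lia. }
    apply (is_lim_seq_scal_l (fun n => exp (u n)) (gauss x N) (exp L)).
    apply is_lim_seq_continuous; [|exact HL].
    apply derivable_continuous_pt, derivable_pt_exp.
Qed.

Lemma rgamma_lim (x : R) : (forall n, x + INR n <> 0) ->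
  rgamma x <> 0 /\ is_lim_seq (gauss x) (rgamma x).
Proof.
  intros Hx. destruct (gauss_cv x Hx) as [l [Hl Hlim]].
  replace (rgamma x) with l; [easy|].
  unfold rgamma. fold (gauss x). now rewrite (is_lim_seq_unique _ _ Hlim).
Qed.

(** * Coefficients of the even and odd parts *)

Lemma poch_neq_0 (a : R) (n : nat) : (forall n, a + INR n <> 0) -> poch a n <> 0.
Proof.
  intros Ha. induction n as [|n IH]; simpl poch; [lra|].
  now apply Rmult_integral_contrapositive_currified.
Qed.

Lemma poch_pos (a : R) (n : nat) : 0 < a -> 0 < poch a n.
Proof.
  intros Ha. induction n as [|n IH]; simpl poch; [lra|].
  apply Rmult_lt_0_compat; [exact IH|]. generalize (pos_INR n); lra.
Qed.

(** With [rgamma_lim] this yields (a)_(n+1) ~ n! n^a / Gamma(a). The index shifts because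
    [prod_f_R0] up to n has n + 1 factors. *)
Lemma poch_gauss (a : R) (n : nat) :
  poch a (S n) = gauss a n * (INR (Factorial.fact n) * Rpower (INR n) a).
Proof.
  assert (H : prod_f_R0 (fun j => a + INR j) n = poch a (S n)).
  { induction n as [|n IH]; [simpl; ring|].
    cbn [prod_f_R0]. rewrite IH. reflexivity. }
  unfold gauss. rewrite H. field. split.
  - apply Rgt_not_eq, exp_pos.
  - apply INR_fact_neq_0.
Qed.

Lemma poch_three_halves (n : nat) : poch (3 / 2) n = poch (/ 2) n * (2 * INR n + 1).
Proof.
  induction n as [|n IH]; [simpl; ring|].
  cbn [poch]. rewrite IH, S_INR. field.
Qed.

Lemma is_lim_seq_shift_ratio (c d : R) :
  is_lim_seq (fun n => (INR n + c) / (INR n + d)) 1.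
Proof.
  assert (H : is_lim_seq (fun n => INR n + d) p_infty).
  { apply is_lim_seq_plus with p_infty d; [apply is_lim_seq_INR| apply is_lim_seq_const|reflexivity]. }
  apply is_lim_seq_ext_loc with (fun n => 1 + (c - d) * / (INR n + d)).
  - apply is_lim_seq_spec in H. destruct (H 0) as [N HN]. exists N; intros n Hn.
    specialize (HN n Hn). field. lra.
  - replace 1 with (1 + (c - d) * 0) at 1 by ring.
    apply is_lim_seq_plus'; [apply is_lim_seq_const|].
    apply (is_lim_seq_scal_l _ (c - d) 0).
    apply (is_lim_seq_inv _ p_infty); [exact H|discriminate].
Qed.

Lemma gauss_neq_0 (x : R) (n : nat) : (forall n, x + INR n <> 0) -> gauss x n <> 0.
Proof.
  intros Hx H. apply (poch_neq_0 x (S n) Hx). rewrite poch_gauss, H; ring.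
Qed.

Lemma gauss_ratio_lim (x : R) : (forall n, x + INR n <> 0) ->
  is_lim_seq (fun n => gauss x n / rgamma x) 1.
Proof.
  intros Hx. destruct (rgamma_lim x Hx) as [H0 H].
  replace 1 with (rgamma x / rgamma x) by (field; exact H0).
  apply is_lim_seq_div'; [exact H|apply is_lim_seq_const|exact H0].
Qed.

(** The bound is a square because AM-GM will later take the root of this constant. *)
Lemma eventually_le_of_lim_1 (u : nat -> R) (e : R) : is_lim_seq u 1 -> 0 < e ->
  eventually (fun n => u n <= (1 + e) ^ 2).
Proof.
  intros H He. apply is_lim_seq_spec in H. destruct (H (mkposreal e He)) as [N HN].
  exists N; intros n Hn. specialize (HN n Hn). simpl in HN.
  apply Rabs_lt_between in HN. nra.
Qed.

(* Coefficients of [z ^ (2 n)] in [kummerM a b (z ^ 2 / 2)]. *)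
Definition kcoef (a b : R) (n : nat) : R :=
  poch a n / (poch b n * INR (Factorial.fact n)) / 2 ^ n.

(* Normalised so that, up to a common factor, [pcfD nu z] is
   [exp (- z ^ 2 / 4) * sum (evc p n z ^ (2 n) - odc p n z ^ (2 n + 1))] with [p = - nu / 2]. *)
Definition evc (p : R) (n : nat) : R := kcoef p (/ 2) n / rgamma p.
Definition odc (p : R) (n : nat) : R :=
  sqrt 2 * kcoef (p + / 2) (3 / 2) n / rgamma (p + / 2).

Section Coefficients.

Variable p : R.
Hypothesis Hp : forall n, p + INR n <> 0.
Hypothesis Hq : forall n, p + / 2 + INR n <> 0.

(** This ratio isolates the only part of the coefficient quotients that is not rational in n. *)
Let theta (n : nat) : R :=
  (gauss (p + / 2) n / rgamma (p + / 2)) / (gauss p n / rgamma p).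

Lemma theta_lim : is_lim_seq theta 1.
Proof.
  replace 1 with (1 / 1) by field.
  apply is_lim_seq_div'; try lra; now apply gauss_ratio_lim.
Qed.

(** The Gauss products at p + 1/2 and at p differ by a factor n^(1/2), which squaring turns into n.
    The factors p + n and p + 1/2 + n come from lowering the index n + 1 to n. *)
Lemma poch_half_shift (n : nat) : (1 <= n)%nat ->
  poch (p + / 2) n * poch (p + / 2) n =
  theta n ^ 2 * (rgamma (p + / 2) / rgamma p) ^ 2 * INR n
  * (poch p n * (p + INR n) / (p + / 2 + INR n)) ^ 2.
Proof.
  intros Hn. assert (Hn0 : 0 < INR n) by (apply lt_0_INR; lia).
  assert (E : poch (p + / 2) n = theta n * (rgamma (p + / 2) / rgamma p) * sqrt (INR n)
              * (poch p n * (p + INR n) / (p + / 2 + INR n))).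
  { change (poch p n * (p + INR n)) with (poch p (S n)).
    assert (E : poch (p + / 2) n = poch (p + / 2) (S n) / (p + / 2 + INR n)).
    { cbn [poch]. field. generalize (Hq n); lra. }
    rewrite E, !poch_gauss, Rpower_plus, Rpower_sqrt by exact Hn0.
    unfold theta.
    generalize (gauss_neq_0 p n Hp) (gauss_neq_0 _ n Hq) (Hq n); intros.
    destruct (rgamma_lim p Hp) as [Hr _]. destruct (rgamma_lim _ Hq) as [Hs _].
    field. repeat split; lra. }
  rewrite E.
  transitivity (theta n ^ 2 * (rgamma (p + / 2) / rgamma p) ^ 2 * (sqrt (INR n) * sqrt (INR n))
    * (poch p n * (p + INR n) / (p + / 2 + INR n)) ^ 2); [ring|].
  now rewrite sqrt_sqrt by lra.
Qed.

(** Exact form of c_(m+1)^2 ~ c_m c_(m+2) for odd m + 1, up to normalisation: every factor before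
    the last product tends to 1. Writing [INR n + 0] fits [is_lim_seq_shift_ratio]. *)
Lemma odc_sqr (n : nat) : (1 <= n)%nat ->
  odc p n ^ 2 =
  theta n ^ 2 * ((INR n + 0) / (INR n + / 2))
  * ((INR n + 1) / (INR n + (p + / 2))) * ((INR n + p) / (INR n + (p + / 2)))
  * (evc p n * evc p (S n)).
Proof.
  intros Hn. assert (Hn0 : 0 < INR n) by (apply lt_0_INR; lia).
  unfold odc, evc, kcoef. rewrite poch_three_halves.
  cbn [poch]. rewrite fact_simpl, mult_INR, S_INR.
  assert (Hc := poch_pos (/ 2) n ltac:(lra)).
  assert (HF := INR_fact_lt_0 n).
  assert (HT := pow_lt 2 n ltac:(lra)).
  destruct (rgamma_lim p Hp) as [Hr _]. destruct (rgamma_lim _ Hq) as [Hs _].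
  assert (HQ := poch_half_shift n Hn).
  assert (H2 := sqrt_sqrt 2 ltac:(lra)).
  specialize (Hq n). specialize (Hp n).
  set (Q := poch (p + / 2) n) in *. set (th := theta n) in *.
  (* Exposing [sqrt 2 * sqrt 2] and [Q * Q] lets [H2] and [HQ] remove the irrational factors. *)
  match goal with |- ?l = _ => replace l with
    ((sqrt 2 * sqrt 2) * (Q * Q) / ((poch (/ 2) n * (2 * INR n + 1)
      * INR (Factorial.fact n)) * 2 ^ n * rgamma (p + / 2)) ^ 2) end.
  2:{ field. repeat split; lra. }
  rewrite H2, HQ. cbn [pow]. field.
  repeat split; lra.
Qed.

(** Companion of [odc_sqr] for even m + 1; the relation of [poch_half_shift] is now used inverted,
    hence [/ theta n]. *)
Lemma evc_sqr (n : nat) : (1 <= n)%nat ->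
  evc p (S n) ^ 2 =
  (/ theta n) ^ 2 * ((INR n + (p + / 2)) / (INR n + 0))
  * ((INR n + 3 / 2) / (INR n + 1))
  * (odc p n * odc p (S n)).
Proof.
  intros Hn. assert (Hn0 : 0 < INR n) by (apply lt_0_INR; lia).
  unfold odc, evc, kcoef. rewrite !poch_three_halves.
  cbn [poch]. rewrite fact_simpl, mult_INR, !S_INR.
  assert (Hc := poch_pos (/ 2) n ltac:(lra)).
  assert (HF := INR_fact_lt_0 n).
  assert (HT := pow_lt 2 n ltac:(lra)).
  destruct (rgamma_lim p Hp) as [Hr _]. destruct (rgamma_lim _ Hq) as [Hs _].
  assert (HQ := poch_half_shift n Hn).
  assert (H2 := sqrt_sqrt 2 ltac:(lra)).
  assert (Hth : theta n <> 0).
  { unfold theta, Rdiv. generalize (gauss_neq_0 p n Hp) (gauss_neq_0 _ n Hq).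
    generalize (gauss p n) (gauss (p + / 2) n); intros g1 g2 Hg1 Hg2.
    repeat (apply Rmult_integral_contrapositive_currified || apply Rinv_neq_0_compat);
      assumption. }
  specialize (Hq n). specialize (Hp n).
  set (Q := poch (p + / 2) n) in *. set (th := theta n) in *.
  match goal with |- _ = ?l => replace l with
    ((sqrt 2 * sqrt 2) * (Q * Q) * (/ th) ^ 2 * ((INR n + (p + / 2)) / (INR n + 0))
  * ((INR n + 3 / 2) / (INR n + 1)) * ((p + / 2 + INR n) / (poch (/ 2) n * (2 * INR n + 1)
     * INR (Factorial.fact n) * 2 ^ n * rgamma (p + / 2)) /
     (poch (/ 2) n * (/ 2 + INR n) * (2 * (INR n + 1) + 1)
     * ((INR n + 1) * INR (Factorial.fact n)) * 2 ^ S n * rgamma (p + / 2)))) end.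
  2:{ cbn [pow]. field. repeat split; lra. }
  rewrite H2, HQ. cbn [pow]. field.
  repeat split; lra.
Qed.

(** Division by [rgamma p] absorbs the sign: [gauss p n / rgamma p] is close to 1 and the remaining
    factors are positive. *)
Lemma evc_pos : eventually (fun n => 0 < evc p n).
Proof.
  assert (H := gauss_ratio_lim p Hp). apply is_lim_seq_spec in H.
  destruct (H (mkposreal 1 Rlt_0_1)) as [N HN].
  exists (S N); intros [|n] Hn; [lia|].
  specialize (HN n ltac:(lia)). simpl in HN. apply Rabs_lt_between in HN.
  unfold evc, kcoef. rewrite poch_gauss.
  replace (gauss p n * _ / _ / _ / _) with ((gauss p n / rgamma p)
    * (INR (Factorial.fact n) * Rpower (INR n) p
       / (poch (/ 2) (S n) * INR (Factorial.fact (S n)) * 2 ^ S n))).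
  - apply Rmult_lt_0_compat; [lra|]. 
    generalize (INR_fact_lt_0 n) (INR_fact_lt_0 (S n)) (exp_pos (p * ln (INR n)))
      (pow_lt 2 (S n) ltac:(lra)) (poch_pos (/ 2) (S n) ltac:(lra)); intros.
    apply Rdiv_lt_0_compat; [now apply Rmult_lt_0_compat|].
    apply Rmult_lt_0_compat; [now apply Rmult_lt_0_compat|assumption].
  - field. repeat split; try apply INR_fact_neq_0; try (apply pow_nonzero; lra).
    + apply Rgt_not_eq, poch_pos; lra.
    + now apply rgamma_lim.
Qed.

Lemma odc_pos : eventually (fun n => 0 < odc p n).
Proof.
  assert (H := gauss_ratio_lim _ Hq). apply is_lim_seq_spec in H.
  destruct (H (mkposreal 1 Rlt_0_1)) as [N HN].
  exists (S N); intros [|n] Hn; [lia|].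
  specialize (HN n ltac:(lia)). simpl in HN. apply Rabs_lt_between in HN.
  unfold odc, kcoef. rewrite poch_gauss.
  set (q := p + / 2) in *.
  replace (sqrt 2 * (gauss q n * _ / _ / _) / _) with ((gauss q n / rgamma q)
    * (sqrt 2 * (INR (Factorial.fact n) * Rpower (INR n) q)
       / (poch (3 / 2) (S n) * INR (Factorial.fact (S n)) * 2 ^ S n))).
  - apply Rmult_lt_0_compat; [lra|]. 
    generalize (INR_fact_lt_0 n) (INR_fact_lt_0 (S n)) (exp_pos (q * ln (INR n)))
      (pow_lt 2 (S n) ltac:(lra)) (poch_pos (3 / 2) (S n) ltac:(lra))
      (sqrt_lt_R0 2 ltac:(lra)); intros.
    apply Rdiv_lt_0_compat; apply Rmult_lt_0_compat; try assumption;
      now apply Rmult_lt_0_compat.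
  - field. repeat split; try apply INR_fact_neq_0; try (apply pow_nonzero; lra).
    + apply Rgt_not_eq, poch_pos; lra.
    + now apply rgamma_lim.
Qed.

Lemma odc_sqr_le (e : R) : 0 < e ->
  eventually (fun n => odc p n ^ 2 <= (1 + e) ^ 2 * (evc p n * evc p (S n))).
Proof.
  intros He.
  destruct (eventually_le_of_lim_1 (fun n => theta n ^ 2 * ((INR n + 0) / (INR n + / 2))
    * ((INR n + 1) / (INR n + (p + / 2))) * ((INR n + p) / (INR n + (p + / 2)))) e) as [N1 H1].
  (* The nested product mirrors the unfolding of [theta n ^ 2] as [theta n * (theta n * 1)]. *)
  { replace (Finite 1) with (Finite (1 * (1 * 1) * 1 * 1 * 1)) by (f_equal; ring).
    repeat apply is_lim_seq_mult'; try apply is_lim_seq_shift_ratio; try apply theta_lim.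
    apply is_lim_seq_const. }
  { exact He. }
  destruct evc_pos as [N2 H2].
  exists (S (N1 + N2)); intros n Hn. rewrite odc_sqr by lia.
  apply Rmult_le_compat_r; [|apply H1; lia].
  apply Rlt_le, Rmult_lt_0_compat; apply H2; lia.
Qed.

Lemma evc_sqr_le (e : R) : 0 < e ->
  eventually (fun n => evc p (S n) ^ 2 <= (1 + e) ^ 2 * (odc p n * odc p (S n))).
Proof.
  intros He.
  destruct (eventually_le_of_lim_1 (fun n => (/ theta n) ^ 2 * ((INR n + (p + / 2)) / (INR n + 0))
  * ((INR n + 3 / 2) / (INR n + 1))) e) as [N1 H1].
  { assert (Hi : is_lim_seq (fun n => / theta n) 1).
    { rewrite <- Rinv_1. apply (is_lim_seq_inv _ 1); [apply theta_lim|].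
      intros E; injection E; lra. }
    replace (Finite 1) with (Finite (1 * (1 * 1) * 1 * 1)) by (f_equal; ring).
    repeat apply is_lim_seq_mult'; try apply is_lim_seq_shift_ratio; try exact Hi.
    apply is_lim_seq_const. }
  { exact He. }
  destruct odc_pos as [N2 H2].
  exists (S (N1 + N2)); intros n Hn. rewrite evc_sqr by lia.
  apply Rmult_le_compat_r; [|apply H1; lia].
  apply Rlt_le, Rmult_lt_0_compat; apply H2; lia.
Qed.

End Coefficients.

(** * Cancellation of interlaced power series *)

Lemma Series_nonneg (a : nat -> R) : (forall n, 0 <= a n) -> ex_series a -> 0 <= Series a.
Proof.
  intros Ha Hs. replace 0 with (Series (fun n => 0 * a n)) by (rewrite Series_scal_l; ring).
  apply Series_le; [|exact Hs]. intros n. generalize (Ha n); lra.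
Qed.

(** AM-GM without square roots, from ((a + b) / 2)^2 - a b = ((a - b) / 2)^2. *)
Lemma le_half_sum_of_sqr_le (c x a b : R) :
  0 <= a -> 0 <= b -> 0 <= c -> x ^ 2 <= c ^ 2 * (a * b) -> x <= c * ((a + b) / 2).
Proof.
  intros Ha Hb Hc H. apply Rnot_lt_le; intros Hlt.
  assert (H0 : 0 <= c * ((a + b) / 2)) by (apply Rmult_le_pos; lra).
  assert (H1 : (c * ((a + b) / 2)) ^ 2 < x ^ 2) by nra.
  assert (H2 : 0 <= c ^ 2 * ((a - b) / 2) ^ 2) by (apply Rmult_le_pos; apply pow2_ge_0).
  nra.
Qed.

(** Let U and V be the two sums. Termwise AM-GM gives V <= (1 + e) U and U - u_0 <= (1 + e) V. Hence
    U - V <= u_0 + e V <= u_0 + e (1 + e) U, and e <= 1 bounds e (1 + e) by 2 e. *)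
Lemma interlaced_series_close (u v : nat -> R) (e : R) :
  0 <= e <= 1 -> (forall n, 0 <= u n) -> (forall n, 0 <= v n) ->
  ex_series u -> ex_series v ->
  (forall n, v n ^ 2 <= (1 + e) ^ 2 * (u n * u (S n))) ->
  (forall n, u (S n) ^ 2 <= (1 + e) ^ 2 * (v n * v (S n))) ->
  Rabs (Series u - Series v) <= u 0%nat + 2 * e * Series u.
Proof.
  intros He Hu Hv Su Sv Huv Hvu.
  assert (Su' := proj1 (ex_series_incr_1 u) Su).
  assert (Sv' := proj1 (ex_series_incr_1 v) Sv).
  assert (main : forall a b : nat -> R, (forall n, 0 <= a n) -> (forall n, 0 <= b n) ->
    ex_series a -> ex_series (fun n => a (S n)) ->
    (forall n, b n ^ 2 <= (1 + e) ^ 2 * (a n * a (S n))) ->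
    Series b <= (1 + e) * Series a).
  { intros a b Ha Hb Sa Sa' H.
    apply Rle_trans with (Series (fun n => (1 + e) / 2 * (a n + a (S n)))).
    - apply Series_le.
      + intros n; split; [apply Hb|].
        replace ((1 + e) / 2 * (a n + a (S n))) with ((1 + e) * ((a n + a (S n)) / 2)) by field.
        apply le_half_sum_of_sqr_le; auto; lra.
      + apply (ex_series_scal ((1 + e) / 2) (fun n => a n + a (S n))).
        now apply (ex_series_plus a (fun n => a (S n))).
    - rewrite Series_scal_l, Series_plus by assumption.
      rewrite (Series_incr_1 a Sa). generalize (Ha 0%nat); intros. nra. }
  assert (H1 := main u v Hu Hv Su Su' Huv).
  (* Each u_(n+1) lies between v_n and v_(n+1), so the roles are exchanged after dropping u_0. *)
  assert (H2 := main v (fun n => u (S n)) Hv (fun n => Hu (S n)) Sv Sv' Hvu).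
  assert (H3 := Series_incr_1 u Su).
  assert (H4 := Series_nonneg u Hu Su). assert (H5 := Hu 0%nat).
  assert (H6 := Series_nonneg v Hv Sv).
  assert (e * Series v <= e * ((1 + e) * Series u)) by (apply Rmult_le_compat_l; lra).
  assert (e * (e * Series u) <= 1 * (e * Series u)).
  { apply Rmult_le_compat_r; [|lra]. apply Rmult_le_pos; lra. }
  assert (0 <= e * Series u) by (apply Rmult_le_pos; lra).
  apply Rabs_le_between. lra.
Qed.

Lemma sum_f_R0_Rabs_le (a b : nat -> R) (N : nat) :
  (forall n, (n <= N)%nat -> Rabs (a n) <= b n) -> Rabs (sum_f_R0 a N) <= sum_f_R0 b N.
Proof.
  intros H. eapply Rle_trans; [apply Rsum_abs|]. now apply sum_Rle.
Qed.

(* The even and the odd part of [sum (-1)^m c_m z^m] cancel to leading order as soon as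
   [c_(m+1)^2 ~ c_m c_(m+2)]: AM-GM bounds each term by the mean of its two neighbours. *)
Lemma even_odd_cancellation (a b : nat -> R) (e : R) :
  CV_radius a = p_infty -> CV_radius b = p_infty ->
  eventually (fun n => 0 < a n) -> eventually (fun n => 0 < b n) ->
  (forall d, 0 < d -> eventually (fun n => b n ^ 2 <= (1 + d) ^ 2 * (a n * a (S n)))) ->
  (forall d, 0 < d -> eventually (fun n => a (S n) ^ 2 <= (1 + d) ^ 2 * (b n * b (S n)))) ->
  0 < e ->
  exists Z, forall z, Z <= z ->
    Rabs (PSeries a (z ^ 2) - z * PSeries b (z ^ 2)) <= e * Rabs (PSeries a (z ^ 2)).
Proof.
  intros Ra Rb [N1 Pa] [N2 Pb] Hba Hab He.
  (* The final error is 3 d U, for U the tail of the even series, while the whole even series is at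
     least U / 2; so d <= e / 6 suffices. The bound 1/2 ensures that the head takes at most half of
     U. *)
  set (d := Rmin (/ 2) (e / 6)).
  assert (Hd : 0 < d) by (apply Rmin_pos; lra).
  assert (Hd1 : d <= / 2) by apply Rmin_l.
  assert (Hd2 : d <= e / 6) by apply Rmin_r.
  destruct (Hba d Hd) as [N3 H3]. destruct (Hab d Hd) as [N4 H4].
  set (N := S (N1 + N2 + N3 + N4)).
  (* [C * s ^ N] dominates the heads of both series together with the first tail term [u 0]. *)
  set (C := sum_f_R0 (fun n => Rabs (a n)) (pred N) + sum_f_R0 (fun n => Rabs (b n)) (pred N)
            + a N).
  assert (PaN : forall k, 0 < a (N + k)%nat) by (intros; apply Pa; unfold N; lia).
  assert (PbN : forall k, 0 < b (N + k)%nat) by (intros; apply Pb; unfold N; lia).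
  assert (PaN0 := PaN O). rewrite Nat.add_0_r in PaN0.
  assert (Hsum : forall f : nat -> R, 0 <= sum_f_R0 (fun n => Rabs (f n)) (pred N)).
  { intros f. apply cond_pos_sum. intros; apply Rabs_pos. }
  assert (HC : 0 <= C) by (unfold C; generalize (Hsum a) (Hsum b); lra).
  assert (Hq : 0 <= C / (d * a (N + 1)%nat)).
  { apply Rdiv_le_0_compat; [exact HC|]. apply Rmult_lt_0_compat; [exact Hd|apply PaN]. }
  (* This makes d a_(N+1) z >= C, so that C s^N <= d a_(N+1) s^(N+1) <= d U; the summand 1 gives z
     >= 1 and thus z <= z ^ 2. *)
  exists (1 + C / (d * a (N + 1)%nat)). intros z Hz.
  set (s := z ^ 2).
  assert (Hzs : z <= s) by (unfold s; nra).
  assert (Hs1 : 1 <= s) by lra.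
  assert (Hpow : forall n, 0 < s ^ n) by (intros; apply pow_lt; lra).
  assert (HsN : forall n, (n <= N)%nat -> s ^ n <= s ^ N) by (intros; now apply Rle_pow).
  assert (Sa : ex_series (fun n => a n * s ^ n)).
  { apply ex_pseries_R, CV_radius_inside. rewrite Ra; exact I. }
  assert (Sb : ex_series (fun n => z * (b n * s ^ n))).
  { apply (ex_series_scal z (fun n => b n * s ^ n)).
    apply ex_pseries_R, CV_radius_inside. rewrite Rb; exact I. }
  unfold PSeries. rewrite <- Series_scal_l.
  rewrite (Series_incr_n _ N) by (try exact Sa; unfold N; lia).
  rewrite (Series_incr_n (fun n => z * (b n * s ^ n)) N) by (try exact Sb; unfold N; lia).
  set (u := fun k => a (N + k)%nat * s ^ (N + k)).
  set (v := fun k => z * (b (N + k)%nat * s ^ (N + k))).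
  assert (Su : ex_series u) by (apply (ex_series_incr_n (fun n => a n * s ^ n) N), Sa).
  assert (Sv : ex_series v).
  { apply (ex_series_incr_n (fun n => z * (b n * s ^ n)) N), Sb. }
  assert (Pu : forall k, 0 <= u k).
  { intros k. left. apply Rmult_lt_0_compat; auto. }
  assert (Pv : forall k, 0 <= v k).
  { intros k. left. apply Rmult_lt_0_compat; [lra|]. apply Rmult_lt_0_compat; auto. }
  assert (Hclose : Rabs (Series u - Series v) <= u 0%nat + 2 * d * Series u).
  { apply interlaced_series_close; auto; [lra| |].
    - intros k. unfold u, v. rewrite Nat.add_succ_r.
      replace ((z * (b (N + k)%nat * s ^ (N + k))) ^ 2)
        with (b (N + k)%nat ^ 2 * (s ^ (N + k) * s ^ S (N + k))) by (unfold s; simpl; ring).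
      replace ((1 + d) ^ 2 * _) with ((1 + d) ^ 2 * (a (N + k)%nat * a (S (N + k)))
        * (s ^ (N + k) * s ^ S (N + k))) by ring.
      apply Rmult_le_compat_r; [|apply H3; unfold N; lia].
      left; apply Rmult_lt_0_compat; auto.
    - intros k. unfold u, v. rewrite Nat.add_succ_r.
      replace ((a (S (N + k)) * s ^ S (N + k)) ^ 2)
        with (a (S (N + k)) ^ 2 * (s ^ S (N + k)) ^ 2) by ring.
      replace ((1 + d) ^ 2 * _) with ((1 + d) ^ 2 * (b (N + k)%nat * b (S (N + k)))
        * (s ^ S (N + k)) ^ 2) by (unfold s; simpl; ring).
      apply Rmult_le_compat_r; [apply pow2_ge_0|apply H4; unfold N; lia]. }
  set (p := sum_f_R0 (fun n => a n * s ^ n) (pred N)).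
  set (r := sum_f_R0 (fun n => z * (b n * s ^ n)) (pred N)).
  assert (Hp : Rabs p <= sum_f_R0 (fun n => Rabs (a n)) (pred N) * s ^ N).
  { rewrite Rmult_comm, scal_sum. apply sum_f_R0_Rabs_le. intros n Hn.
    rewrite Rabs_mult, (Rabs_pos_eq (s ^ n)) by (left; apply Hpow).
    apply Rmult_le_compat_l; [apply Rabs_pos|apply HsN; lia]. }
  assert (Hr : Rabs r <= sum_f_R0 (fun n => Rabs (b n)) (pred N) * s ^ N).
  { rewrite Rmult_comm, scal_sum. apply sum_f_R0_Rabs_le. intros n Hn.
    rewrite !Rabs_mult, (Rabs_pos_eq z), (Rabs_pos_eq (s ^ n)) by (try (left; apply Hpow); lra).
    replace (z * (Rabs (b n) * s ^ n)) with (Rabs (b n) * (z * s ^ n)) by ring.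
    apply Rmult_le_compat_l; [apply Rabs_pos|].
    apply Rle_trans with (s ^ S n); [|apply HsN; unfold N in *; lia].
    simpl. apply Rmult_le_compat_r; [left; apply Hpow|exact Hzs]. }
  (* A single tail term, of degree in s one above the bound on the heads, is enough to absorb
     them. *)
  assert (HT : a (N + 1)%nat * s ^ (N + 1) <= Series u).
  { rewrite (Series_incr_n u 2) by (lia || exact Su). simpl sum_f_R0.
    assert (0 <= Series (fun k => u (2 + k)%nat)).
    { apply Series_nonneg; [intros; apply Pu|]. now apply (ex_series_incr_n u 2). }
    generalize (Pu 0%nat). change (a (N + 1)%nat * s ^ (N + 1)) with (u 1%nat).
    simpl in H |- *. lra. }
  assert (HCT : C * s ^ N <= d * Series u).
  { apply Rle_trans with (d * (a (N + 1)%nat * s ^ (N + 1)));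
      [|apply Rmult_le_compat_l; lra].
    rewrite pow_add, pow_1.
    replace (d * _) with (d * a (N + 1)%nat * s * s ^ N) by ring.
    apply Rmult_le_compat_r; [left; apply Hpow|].
    assert (Hda : 0 < d * a (N + 1)%nat) by (apply Rmult_lt_0_compat; [exact Hd|apply PaN]).
    apply Rle_trans with (d * a (N + 1)%nat * (C / (d * a (N + 1)%nat))).
    - right. field. split; [apply Rgt_not_eq, PaN|lra].
    - apply Rmult_le_compat_l; lra. }
  assert (HU : 0 <= Series u) by (apply Series_nonneg; assumption).
  assert (Hu0 : u 0%nat = a N * s ^ N) by (unfold u; now rewrite Nat.add_0_r).
  change (Rabs (p + Series u - (r + Series v)) <= e * Rabs (p + Series u)).
  unfold C in HCT. rewrite !Rmult_plus_distr_r in HCT.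
  assert (Hsu : forall f : nat -> R, 0 <= sum_f_R0 (fun n => Rabs (f n)) (pred N) * s ^ N).
  { intros f. apply Rmult_le_pos; [apply Hsum|left; apply Hpow]. }
  assert (HaN : 0 <= a N * s ^ N) by (apply Rmult_le_pos; [lra|left; apply Hpow]).
  assert (Ha0 := Hsu a). assert (Hb0 := Hsu b).
  assert (HdU : d * Series u <= / 2 * Series u) by (apply Rmult_le_compat_r; lra).
  assert (HE : / 2 * Series u <= Rabs (p + Series u)).
  { apply Rabs_le_between in Hp. generalize (Rle_abs (p + Series u)); lra. }
  (* The heads and [u 0] contribute at most d U, the difference of the tails another 2 d U. *)
  apply Rle_trans with (3 * d * Series u).
  - apply Rabs_le_between in Hp. apply Rabs_le_between in Hr.
    apply Rabs_le_between in Hclose. apply Rabs_le_between. lra.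
  - apply Rle_trans with (e * (/ 2 * Series u)).
    + replace (e * (/ 2 * Series u)) with (3 * (e / 6) * Series u) by field.
      apply Rmult_le_compat_r; lra.
    + apply Rmult_le_compat_l; lra.
Qed.

(** * Subdominant solutions of second-order equations *)

Lemma le_of_derive_nonneg (f df : R -> R) (a b : R) :
  (forall x, a <= x <= b -> is_derive f x (df x)) ->
  (forall x, a <= x <= b -> 0 <= df x) -> a <= b -> f a <= f b.
Proof.
  intros Hd Hp Hab.
  destruct (MVT_gen f a b df) as [c [Hc E]];
    rewrite ?Rmin_left, ?Rmax_right in * by exact Hab.
  - intros x Hx; apply Hd; lra.
  - intros x Hx. apply derivable_continuous_pt. exists (df x).
    apply is_derive_Reals, Hd; lra.
  - assert (0 <= df c * (b - a)) by (apply Rmult_le_pos; [apply Hp|]; lra). lra.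
Qed.

Section Recessive.

Variables (q y dy : R -> R) (A : R).
Hypothesis Hy : forall x, is_derive y x (dy x).
Hypothesis Hdy : forall x, is_derive dy x (q x * y x).
Hypothesis Hq : forall x, A <= x -> 1 <= q x.

Lemma mul_derive_is_derive (x : R) :
  is_derive (fun x => y x * dy x) x (dy x ^ 2 + q x * y x ^ 2).
Proof.
  replace (dy x ^ 2 + q x * y x ^ 2) with (dy x * dy x + y x * (q x * y x)) by ring.
  apply (is_derive_mult y dy x (dy x) (q x * y x)); [apply Hy|apply Hdy|].
  intros; apply Rmult_comm.
Qed.

Lemma mul_derive_mono (a b : R) : A <= a -> a <= b -> y a * dy a <= y b * dy b.
Proof.
  intros Ha Hab.
  apply (le_of_derive_nonneg (fun x => y x * dy x) (fun x => dy x ^ 2 + q x * y x ^ 2));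
    [intros; apply mul_derive_is_derive| |exact Hab].
  intros x Hx. generalize (Hq x ltac:(lra)); intros. nra.
Qed.

(** As (y^2 + y'^2)' = 2 (1 + q) y y' <= 0, the energy y^2 + y'^2 is nonincreasing. It is at most (y
    y')' = y'^2 + q y^2, and y y' can grow by at most - y(A) y'(A), so the energy at x times x - A
    stays bounded. *)
Lemma nonpos_mul_derive_decay (e : R) :
  (forall x, A <= x -> y x * dy x <= 0) -> 0 < e ->
  exists Z, forall x, Z <= x -> y x ^ 2 + dy x ^ 2 <= e.
Proof.
  intros Hn He.
  assert (Hmono : forall a b, A <= a -> a <= b -> y b ^ 2 + dy b ^ 2 <= y a ^ 2 + dy a ^ 2).
  { intros a b Ha Hab.
    enough (- (y a ^ 2 + dy a ^ 2) <= - (y b ^ 2 + dy b ^ 2)) by lra.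
    apply (le_of_derive_nonneg (fun x => - (y x ^ 2 + dy x ^ 2))
       (fun x => - (2 * (1 + q x) * (y x * dy x)))); [| |exact Hab].
    - intros x _. assert (H1 : is_derive (fun x : R => y x) x (dy x)) by apply Hy. assert (H2 : is_derive (fun x : R => dy x) x (q x * y x)) by apply Hdy. auto_derive.
      + repeat split; eexists; eassumption.
      + rewrite (is_derive_unique _ _ _ H1), (is_derive_unique _ _ _ H2). ring.
    - intros x Hx. generalize (Hq x ltac:(lra)) (Hn x ltac:(lra)); intros. nra. }
  set (C := - (y A * dy A)).
  assert (HC : 0 <= C) by (unfold C; generalize (Hn A (Rle_refl A)); lra).
  assert (HCe : 0 <= C / e) by (apply Rdiv_le_0_compat; lra).
  (* Then x - A >= C / e brings the energy below e; the extra 1 keeps x - A positive. *)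
  exists (A + C / e + 1). intros x Hx.
  destruct (MVT_gen (fun x => y x * dy x) A x (fun x => dy x ^ 2 + q x * y x ^ 2))
    as [c [Hc E]]; rewrite ?Rmin_left, ?Rmax_right in * by lra.
  - intros; apply mul_derive_is_derive.
  - intros. apply derivable_continuous_pt. eexists.
    apply is_derive_Reals, mul_derive_is_derive.
  - assert (H1 := Hmono c x ltac:(lra) ltac:(lra)).
    assert (H2 := Hq c ltac:(lra)). assert (H3 := Hn x ltac:(lra)).
    assert (H4 : y c ^ 2 + dy c ^ 2 <= dy c ^ 2 + q c * y c ^ 2) by nra.
    assert (H5 : (y x ^ 2 + dy x ^ 2) * (x - A) <= C).
    { apply Rle_trans with ((dy c ^ 2 + q c * y c ^ 2) * (x - A));
        [apply Rmult_le_compat_r; lra|unfold C; lra]. }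
    apply Rmult_le_reg_r with (x - A); [lra|].
    apply Rle_trans with C; [exact H5|].
    replace C with (e * (C / e)) by (field; lra). apply Rmult_le_compat_l; lra.
Qed.

(* If [y y' > 0] at [x0], then [(1 / (y y'))' <= - 1 / y ^ 2] while [(u / y)' = W / y ^ 2]
   for the constant Wronskian [W], so [u / y] is bounded: [y] cannot be subdominant. *)
Lemma dominant_of_pos_mul_derive (u du : R -> R) (x0 : R) :
  (forall x, is_derive u x (du x)) -> (forall x, is_derive du x (q x * u x)) ->
  A <= x0 -> 0 < y x0 * dy x0 ->
  exists C, 0 < C /\ forall x, x0 <= x -> 0 < Rabs (y x) /\ Rabs (u x) <= C * Rabs (y x).
Proof.
  intros Hu Hdu Hx0 Hpos.
  assert (HP : forall x, x0 <= x -> 0 < y x * dy x).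
  { intros x Hx. eapply Rlt_le_trans; [exact Hpos|]. now apply mul_derive_mono. }
  assert (Hne : forall x, x0 <= x -> y x <> 0 /\ dy x <> 0).
  { intros x Hx. specialize (HP x Hx). split; intros E; rewrite E in HP; lra. }
  set (W := fun x => y x * du x - dy x * u x).
  assert (HW : forall x, is_derive W x 0).
  { intros x. unfold W. assert (H1 : is_derive (fun x : R => y x) x (dy x)) by apply Hy. assert (H2 : is_derive (fun x : R => dy x) x (q x * y x)) by apply Hdy.
    assert (H3 : is_derive (fun x : R => u x) x (du x)) by apply Hu. assert (H4 : is_derive (fun x : R => du x) x (q x * u x)) by apply Hdu. auto_derive.
    - repeat split; eexists; eassumption.
    - rewrite (is_derive_unique _ _ _ H1), (is_derive_unique _ _ _ H2),
        (is_derive_unique _ _ _ H3), (is_derive_unique _ _ _ H4). ring. }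
  assert (HWc : forall x, x0 <= x -> W x = W x0).
  { intros x Hx. apply Rle_antisym.
    - enough (- W x0 <= - W x) by lra.
      apply (le_of_derive_nonneg (fun x => - W x) (fun _ => - 0)); [|intros; lra|exact Hx].
      intros z _. apply (is_derive_opp W z 0), HW.
    - apply (le_of_derive_nonneg W (fun _ => 0)); [|intros; lra|exact Hx].
      intros z _. apply HW. }
  set (K := Rabs (W x0)).
  set (G := fun x => / (y x * dy x)).
  assert (HG : forall x, x0 <= x -> 0 < G x) by (intros; apply Rinv_0_lt_compat; auto).
  (* For s = 1 and s = -1 the function s u / y + K / (y y') is nonincreasing, which yields the two
     one-sided bounds on u / y. *)
  assert (Hb : forall s, Rabs s = 1 -> forall x, x0 <= x ->
      s * (u x / y x) + K * G x <= s * (u x0 / y x0) + K * G x0).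
  { intros s Hs x Hx.
    enough (- (s * (u x0 / y x0) + K * G x0) <= - (s * (u x / y x) + K * G x)) by lra.
    apply (le_of_derive_nonneg (fun x => - (s * (u x / y x) + K * G x))
      (fun x => (K - s * W x0) / y x ^ 2 + K * q x / dy x ^ 2)); [| |exact Hx].
    - intros z Hz. destruct (Hne z (proj1 Hz)) as [N1 N2].
      assert (H1 : is_derive (fun x : R => y x) z (dy z)) by apply Hy. assert (H2 : is_derive (fun x : R => dy x) z (q z * y z)) by apply Hdy. assert (H3 : is_derive (fun x : R => u x) z (du z)) by apply Hu.
      rewrite <- (HWc z (proj1 Hz)). unfold G, W. auto_derive.
      + repeat split; try (eexists; eassumption); try exact N1.
        apply Rmult_integral_contrapositive_currified; assumption.
      + rewrite (is_derive_unique _ _ _ H1), (is_derive_unique _ _ _ H2),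
          (is_derive_unique _ _ _ H3). field. split; assumption.
    - intros z Hz. destruct (Hne z (proj1 Hz)) as [N1 N2].
      assert (Hs' : s * W x0 <= K).
      { apply Rle_trans with (Rabs (s * W x0)); [apply Rle_abs|].
        rewrite Rabs_mult, Hs. unfold K; lra. }
      assert (HK : 0 <= K) by apply Rabs_pos.
      assert (Hqz := Hq z ltac:(lra)).
      apply Rplus_le_le_0_compat; apply Rdiv_le_0_compat;
        try (apply pow2_gt_0; assumption); nra. }
  set (C := Rabs (u x0 / y x0) + K * G x0).
  assert (HK : 0 <= K) by apply Rabs_pos.
  assert (HG0 := HG x0 (Rle_refl _)).
  assert (HKG : 0 <= K * G x0) by nra.
  exists (C + 1). split; [unfold C; generalize (Rabs_pos (u x0 / y x0)); lra|].
  intros x Hx. destruct (Hne x Hx) as [N1 N2].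
  split; [now apply Rabs_pos_lt|].
  assert (HKx : 0 <= K * G x) by (generalize (HG x Hx); nra).
  assert (B1 := Hb 1 Rabs_R1 x Hx).
  assert (B2 := Hb (- (1)) ltac:(rewrite Rabs_Ropp; apply Rabs_R1) x Hx).
  assert (Hr : Rabs (u x / y x) <= C).
  { unfold C. apply Rabs_le_between.
    generalize (Rle_abs (u x0 / y x0)) (Rle_abs (- (u x0 / y x0))).
    rewrite Rabs_Ropp. lra. }
  replace (u x) with ((u x / y x) * y x) by (field; exact N1).
  rewrite Rabs_mult. apply Rmult_le_compat_r; [apply Rabs_pos|lra].
Qed.

(** If y y' > 0 at some point past A, then |u| <= C |y| with y nonzero beyond it, against |y| <= |u|
    / (2 C) far out. So y y' <= 0 on the whole half-line. *)
Lemma subdominant_decay (u du : R -> R) (e : R) :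
  (forall x, is_derive u x (du x)) -> (forall x, is_derive du x (q x * u x)) ->
  (forall e, 0 < e -> exists Z, forall x, Z <= x -> Rabs (y x) <= e * Rabs (u x)) ->
  0 < e -> exists Z, forall x, Z <= x -> y x ^ 2 + dy x ^ 2 <= e.
Proof.
  intros Hu Hdu Hsub He. apply nonpos_mul_derive_decay; [|exact He].
  intros x0 Hx0. apply Rnot_lt_le. intros Hpos.
  destruct (dominant_of_pos_mul_derive u du x0 Hu Hdu Hx0 Hpos) as [C [HC HCx]].
  destruct (Hsub (/ (2 * C))) as [Z HZ]; [apply Rinv_0_lt_compat; lra|].
  specialize (HZ (Rmax Z x0) (Rmax_l _ _)).
  destruct (HCx (Rmax Z x0) (Rmax_r _ _)) as [H1 H2].
  set (Y := Rabs (y (Rmax Z x0))) in *. set (U := Rabs (u (Rmax Z x0))) in *.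
  assert (/ (2 * C) * U <= / (2 * C) * (C * Y)).
  { apply Rmult_le_compat_l; [left; apply Rinv_0_lt_compat; lra|exact H2]. }
  replace (/ (2 * C) * (C * Y)) with (Y / 2) in H by (field; lra).
  lra.
Qed.

End Recessive.

(** * Power series solutions of the Hermite equation *)

Lemma kcoef_succ (a b : R) (n : nat) : 0 < b ->
  kcoef a b (S n) = kcoef a b n * ((INR n + a) / (INR n + b) * / (2 * (INR n + 1))).
Proof.
  intros Hb. unfold kcoef. cbn [poch pow]. rewrite fact_simpl, mult_INR, S_INR.
  generalize (poch_pos b n Hb) (INR_fact_lt_0 n) (pow_lt 2 n ltac:(lra)) (pos_INR n); intros.
  field. repeat split; lra.
Qed.

(** Ratio test, with ratio tending to 0; the condition on [a] keeps the coefficients nonzero. *)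
Lemma kcoef_CV_radius (a b : R) :
  (forall n, a + INR n <> 0) -> 0 < b -> CV_radius (kcoef a b) = p_infty.
Proof.
  intros Ha Hb.
  assert (Hne : forall n, kcoef a b n <> 0).
  { intros n. unfold kcoef, Rdiv.
    repeat apply Rmult_integral_contrapositive_currified; try apply Rinv_neq_0_compat.
    - now apply poch_neq_0.
    - apply Rmult_integral_contrapositive_currified; [|apply INR_fact_neq_0].
      now apply Rgt_not_eq, poch_pos.
    - apply pow_nonzero; lra. }
  apply CV_radius_infinite_DAlembert; [exact Hne|].
  apply is_lim_seq_ext with
    (fun n => Rabs ((INR n + a) / (INR n + b) * / (2 * (INR n + 1)))).
  { intros n. f_equal. rewrite kcoef_succ by exact Hb. field.
    generalize (pos_INR n); intros. split; [|split]; try lra. apply Hne. }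
  replace (Finite 0) with (Rbar_abs (1 * 0)) by (simpl; rewrite Rmult_0_r, Rabs_R0; reflexivity).
  apply is_lim_seq_abs.
  apply is_lim_seq_mult'; [apply is_lim_seq_shift_ratio|].
  apply (is_lim_seq_inv _ p_infty); [|discriminate].
  apply is_lim_seq_ext with (fun n => 2 * INR (S n)); [intros; now rewrite S_INR|].
  replace p_infty with (Rbar_mult 2 p_infty).
  - apply is_lim_seq_scal_l. apply (is_lim_seq_incr_1 INR), is_lim_seq_INR.
  - simpl. case Rle_dec; [|lra]. intros H. case Rle_lt_or_eq_dec; [reflexivity|lra].
Qed.

Lemma kummerM_half (a b x : R) : kummerM a b (x / 2) = PSeries (kcoef a b) x.
Proof.
  apply Series_ext; intros n. unfold kcoef, Rdiv.
  rewrite Rpow_mult_distr, pow_inv. ring.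
Qed.

(* Taylor coefficients of the solution of [w'' = z w' - nu w], [w 0 = c0], [w' 0 = c1]. *)
Fixpoint hcoef (nu c0 c1 : R) (m : nat) : R :=
  match m with
  | O => c0
  | S m' => match m' with
            | O => c1
            | S k => (INR k - nu) / ((INR k + 1) * (INR k + 2)) * hcoef nu c0 c1 k
            end
  end.

Lemma hcoef_succ_succ (nu c0 c1 : R) (k : nat) :
  hcoef nu c0 c1 (S (S k)) = (INR k - nu) / ((INR k + 1) * (INR k + 2)) * hcoef nu c0 c1 k.
Proof. reflexivity. Qed.

(** At k = 2 n the recurrence factor is (n - nu / 2) / ((n + 1/2) 2 (n + 1)), the ratio of
    consecutive Kummer coefficients. *)
Lemma hcoef_even (nu c0 c1 : R) (n : nat) :
  hcoef nu c0 c1 (2 * n) = c0 * kcoef (- nu / 2) (/ 2) n.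
Proof.
  induction n as [|n IH].
  - unfold kcoef. simpl. field.
  - replace (2 * S n)%nat with (S (S (2 * n))) by lia.
    rewrite hcoef_succ_succ, IH, kcoef_succ, mult_INR by lra. simpl (INR 2).
    generalize (pos_INR n); intros. field. repeat split; lra.
Qed.

Lemma hcoef_odd (nu c0 c1 : R) (n : nat) :
  hcoef nu c0 c1 (2 * n + 1) = c1 * kcoef ((1 - nu) / 2) (3 / 2) n.
Proof.
  induction n as [|n IH].
  - unfold kcoef. simpl. field.
  - replace (2 * S n + 1)%nat with (S (S (2 * n + 1))) by lia.
    rewrite hcoef_succ_succ, IH, kcoef_succ, plus_INR, mult_INR by lra. simpl (INR 2). simpl (INR 1).
    generalize (pos_INR n); intros. field. repeat split; lra.
Qed.

(** Convergence at r + 1 bounds the terms there, which is impossible for a finite radius r; the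
    point 0 excludes the value minus infinity. *)
Lemma CV_radius_infinite_of_ex_pseries (a : nat -> R) :
  (forall x, ex_pseries a x) -> CV_radius a = p_infty.
Proof.
  intros Ha. destruct (CV_radius_bounded a) as [Hub _].
  destruct (CV_radius a) as [r| |] eqn:E; [exfalso|reflexivity|exfalso].
  1: assert (H := Hub (r + 1)). 2: assert (H := Hub 0).
  all: assert (Hlim : forall x, exists M, forall n, Rabs (a n * x ^ n) <= M).
  1, 3: intros x; assert (Hx := proj1 (ex_pseries_R a x) (Ha x));
    apply ex_series_lim_0 in Hx;
    destruct (filterlim_bounded (fun n => a n * x ^ n)) as [M HM]; [now exists 0|];
    exists M; intros n; apply HM.
  - specialize (H (Hlim _)). simpl in H. lra.
  - exact (H (Hlim _)).
Qed.

Section Hermite.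

Variable nu : R.
Hypothesis Hp : forall n, - nu / 2 + INR n <> 0.
Hypothesis Hq : forall n, (1 - nu) / 2 + INR n <> 0.
Variables c0 c1 : R.

Let h := hcoef nu c0 c1.

Lemma hcoef_even_ex (x : R) : ex_pseries (fun n => h (2 * n)%nat) x.
Proof.
  apply ex_pseries_ext with (PS_scal c0 (kcoef (- nu / 2) (/ 2))).
  { intros n. unfold h. now rewrite hcoef_even. }
  apply ex_pseries_scal; [apply Rmult_comm|].
  apply CV_radius_inside. rewrite kcoef_CV_radius by (exact Hp || lra). exact I.
Qed.

Lemma hcoef_odd_ex (x : R) : ex_pseries (fun n => h (2 * n + 1)%nat) x.
Proof.
  apply ex_pseries_ext with (PS_scal c1 (kcoef ((1 - nu) / 2) (3 / 2))).
  { intros n. unfold h. now rewrite hcoef_odd. }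
  apply ex_pseries_scal; [apply Rmult_comm|].
  apply CV_radius_inside. rewrite kcoef_CV_radius by (exact Hq || lra). exact I.
Qed.

(** The recurrence links indices two apart and [c0] or [c1] may be 0, so convergence is obtained
    separately for the even and odd parts. *)
Lemma hcoef_CV_radius : CV_radius h = p_infty.
Proof.
  apply CV_radius_infinite_of_ex_pseries. intros x.
  apply ex_pseries_odd_even; [apply hcoef_even_ex|apply hcoef_odd_ex].
Qed.

Lemma hcoef_PSeries (z : R) :
  PSeries h z = c0 * PSeries (kcoef (- nu / 2) (/ 2)) (z ^ 2)
                + c1 * (z * PSeries (kcoef ((1 - nu) / 2) (3 / 2)) (z ^ 2)).
Proof.
  rewrite PSeries_odd_even by (apply hcoef_even_ex || apply hcoef_odd_ex).
  rewrite (PSeries_ext (fun n => h (2 * n)%nat) (PS_scal c0 (kcoef (- nu / 2) (/ 2))))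
    by (intros n; unfold h; now rewrite hcoef_even).
  rewrite (PSeries_ext (fun n => h (2 * n + 1)%nat) (PS_scal c1 (kcoef ((1 - nu) / 2) (3 / 2))))
    by (intros n; unfold h; now rewrite hcoef_odd).
  rewrite !PSeries_scal. ring.
Qed.

(** Comparison of coefficients: (n + 1) (n + 2) h_(n+2) = (n - nu) h_n. *)
Lemma hermite_ode (z : R) :
  PSeries (PS_derive (PS_derive h)) z = z * PSeries (PS_derive h) z - nu * PSeries h z.
Proof.
  assert (Hr : forall x, Rbar_lt (Rabs x) (CV_radius h)).
  { intros x. rewrite hcoef_CV_radius. exact I. }
  rewrite <- PSeries_incr_1, <- PSeries_scal, <- PSeries_minus.
  - apply PSeries_ext; intros n. unfold PS_minus, PS_plus, PS_opp, PS_scal, PS_derive.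
    unfold h. rewrite hcoef_succ_succ.
    change plus with Rplus. change opp with Ropp. change scal with Rmult.
    (* The constant coefficient is separate, since multiplication by z puts a 0 there. *)
    destruct n as [|n]; unfold PS_incr_1; change zero with 0;
      rewrite ?S_INR; simpl (INR 0); [field|].
    generalize (pos_INR n); intros. field. lra.
  - apply (ex_pseries_incr_1 (PS_derive h)), ex_pseries_derive, Hr.
  - apply ex_pseries_scal; [apply Rmult_comm|]. apply CV_radius_inside, Hr.
Qed.

(** The Gaussian factor removes the first-order term of the Hermite equation. Free initial data
    cover both [pcfD nu] and the even solution it is compared with. *)
Definition weber (z : R) : R := exp (- z ^ 2 / 4) * PSeries h z.
Definition weber' (z : R) : R :=
  exp (- z ^ 2 / 4) * (PSeries (PS_derive h) z - z / 2 * PSeries h z).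

Lemma weber_is_derive (z : R) : is_derive weber z (weber' z).
Proof.
  assert (H : is_derive (fun x : R => PSeries h x) z (PSeries (PS_derive h) z)).
  { apply is_derive_PSeries. rewrite hcoef_CV_radius. exact I. }
  unfold weber, weber'. auto_derive.
  - eexists; exact H.
  - rewrite (is_derive_unique _ _ _ H). 
    change (- (z * (z * 1)) * / 4) with (- z ^ 2 / 4). field.
Qed.

Lemma weber'_is_derive (z : R) :
  is_derive weber' z ((z ^ 2 / 4 - nu - / 2) * weber z).
Proof.
  assert (H : is_derive (fun x : R => PSeries h x) z (PSeries (PS_derive h) z)).
  { apply is_derive_PSeries. rewrite hcoef_CV_radius. exact I. }
  assert (H' : is_derive (fun x : R => PSeries (PS_derive h) x) z
     (PSeries (PS_derive (PS_derive h)) z)).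
  { apply is_derive_PSeries. rewrite CV_radius_derive, hcoef_CV_radius. exact I. }
  unfold weber, weber'. auto_derive.
  - repeat split; eexists; eassumption.
  - rewrite (is_derive_unique _ _ _ H), (is_derive_unique _ _ _ H'), hermite_ode.
    change (- (z * (z * 1)) * / 4) with (- z ^ 2 / 4). field.
Qed.

End Hermite.

(** * Parabolic cylinder functions *)

(** With [pcfD1], these are U(a,0) and U'(a,0) at a = - nu - 1/2, the initial data of D_nu. *)
Definition pcfD0 (nu : R) : R :=
  sqrt PI / Rpower 2 (- nu / 2) * rgamma ((1 - nu) / 2).
Definition pcfD1 (nu : R) : R :=
  - (sqrt PI / Rpower 2 (- nu / 2 - / 2) * rgamma (- nu / 2)).

Definition pcfD' (nu : R) : R -> R := weber' nu (pcfD0 nu) (pcfD1 nu).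

Section PCF.

Variable nu : R.
Hypothesis Hnu : forall n, nu <> INR n.

(** Even values of nu are the poles of Gamma(- nu / 2), odd ones those of Gamma((1 - nu) / 2);
    excluding the naturals avoids both. *)
Lemma even_parameter_neq (n : nat) : - nu / 2 + INR n <> 0.
Proof.
  intros E. apply (Hnu (2 * n)). rewrite mult_INR. simpl (INR 2). lra.
Qed.

Lemma odd_parameter_neq (n : nat) : (1 - nu) / 2 + INR n <> 0.
Proof.
  intros E. apply (Hnu (2 * n + 1)). rewrite plus_INR, mult_INR.
  simpl (INR 2). simpl (INR 1). lra.
Qed.

Let Hp := even_parameter_neq.
Let Hq := odd_parameter_neq.

Lemma pcfD_weber (z : R) : pcfD nu z = weber nu (pcfD0 nu) (pcfD1 nu) z.
Proof.
  unfold weber. rewrite hcoef_PSeries by assumption.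
  rewrite <- !kummerM_half. unfold pcfD, pcfU, pcfD0, pcfD1.
  replace ((- nu - / 2) / 2 + / 4) with (- nu / 2) by field.
  replace ((- nu - / 2) / 2 - / 4) with (- nu / 2 - / 2) by field.
  replace (3 / 4 + (- nu - / 2) / 2) with ((1 - nu) / 2) by field.
  replace (/ 4 + (- nu - / 2) / 2) with (- nu / 2) by field.
  replace ((- nu - / 2) / 2 + 3 / 4) with ((1 - nu) / 2) by field.
  ring.
Qed.

Lemma pcfD_is_derive (z : R) : is_derive (pcfD nu) z (pcfD' nu z).
Proof.
  apply is_derive_ext with (weber nu (pcfD0 nu) (pcfD1 nu)).
  { intros; now rewrite pcfD_weber. }
  now apply weber_is_derive.
Qed.

Lemma pcfD'_is_derive (z : R) :
  is_derive (pcfD' nu) z ((z ^ 2 / 4 - nu - / 2) * pcfD nu z).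
Proof.
  rewrite pcfD_weber. now apply weber'_is_derive.
Qed.

Lemma pcfD_at_0 : pcfD nu 0 = pcfD0 nu.
Proof.
  rewrite pcfD_weber. unfold weber. rewrite PSeries_0.
  replace (- 0 ^ 2 / 4) with 0 by field. rewrite exp_0. simpl. ring.
Qed.

Lemma pcfD'_at_0 : pcfD' nu 0 = pcfD1 nu.
Proof.
  unfold pcfD', weber'. rewrite !PSeries_0.
  replace (- 0 ^ 2 / 4) with 0 by field. rewrite exp_0.
  unfold PS_derive. simpl. field.
Qed.

(** The comparison function is the even part of D_nu itself, so the claim is the cancellation
    between its even and odd parts. *)
Lemma pcfD_subdominant (e : R) : 0 < e ->
  exists Z, forall z, Z <= z ->
    Rabs (pcfD nu z) <= e * Rabs (weber nu (pcfD0 nu) 0 z).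
Proof.
  intros He. set (p := - nu / 2).
  assert (Ep : (1 - nu) / 2 = p + / 2) by (unfold p; field).
  assert (Hq' : forall n, p + / 2 + INR n <> 0) by (rewrite <- Ep; exact Hq).
  destruct (rgamma_lim p Hp) as [Hr _]. destruct (rgamma_lim _ Hq') as [Hs _].
  assert (Hs2 : sqrt 2 <> 0) by (apply Rgt_not_eq, sqrt_lt_R0; lra).
  assert (Ra := kcoef_CV_radius p (/ 2) Hp ltac:(lra)).
  assert (Rb := kcoef_CV_radius (p + / 2) (3 / 2) Hq' ltac:(lra)).
  assert (Ea : forall x, PSeries (evc p) x = PSeries (kcoef p (/ 2)) x / rgamma p).
  { intros x. rewrite (PSeries_ext _ (PS_scal (/ rgamma p) (kcoef p (/ 2)))).
    - rewrite PSeries_scal. field. exact Hr.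
    - intros n. apply Rmult_comm. }
  assert (Eb : forall x, PSeries (odc p) x
            = sqrt 2 * PSeries (kcoef (p + / 2) (3 / 2)) x / rgamma (p + / 2)).
  { intros x.
    rewrite (PSeries_ext _ (PS_scal (sqrt 2 / rgamma (p + / 2)) (kcoef (p + / 2) (3 / 2)))).
    - rewrite PSeries_scal. field. exact Hs.
    - intros n. unfold odc, PS_scal. change scal with Rmult. field. exact Hs. }
  destruct (even_odd_cancellation (evc p) (odc p) e) as [Z HZ].
  - rewrite (CV_radius_ext _ (PS_scal (/ rgamma p) (kcoef p (/ 2)))).
    + rewrite CV_radius_scal; [exact Ra|now apply Rinv_neq_0_compat].
    + intros n. apply Rmult_comm.
  - rewrite (CV_radius_ext _ (PS_scal (sqrt 2 / rgamma (p + / 2)) (kcoef (p + / 2) (3 / 2)))).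
    + rewrite CV_radius_scal; [exact Rb|].
      apply Rmult_integral_contrapositive_currified; [exact Hs2|now apply Rinv_neq_0_compat].
    + intros n. unfold odc, PS_scal. change scal with Rmult. field. exact Hs.
  - now apply evc_pos.
  - now apply odc_pos.
  - intros; now apply odc_sqr_le.
  - intros; now apply evc_sqr_le.
  - exact He.
  - exists Z. intros z Hz. specialize (HZ z Hz).
    rewrite pcfD_weber. unfold weber. rewrite !hcoef_PSeries by assumption.
    fold p. rewrite Ep.
    (* The common factor of both parts once the coefficients are normalised as [evc] and [odc]. *)
    set (K := exp (- z ^ 2 / 4) * (sqrt PI / Rpower 2 p * rgamma p * rgamma (p + / 2))).
    assert (HR : Rpower 2 p <> 0) by apply Rgt_not_eq, exp_pos.
    replace (exp (- z ^ 2 / 4) * _) with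
      (K * (PSeries (evc p) (z ^ 2) - z * PSeries (odc p) (z ^ 2))).
    2:{ rewrite Ea, Eb. unfold K, pcfD0, pcfD1. fold p. rewrite Ep.
        (* The relation 2^(p - 1/2) = 2^p / sqrt 2 accounts for the [sqrt 2] in [odc]. *)
        unfold Rminus at 2. rewrite Rpower_plus, Rpower_Ropp, Rpower_sqrt by lra.
        field. repeat split; assumption. }
    replace (exp (- z ^ 2 / 4) * _) with (K * PSeries (evc p) (z ^ 2)).
    2:{ rewrite Ea. unfold K, pcfD0. fold p. rewrite Ep. field. split; assumption. }
    rewrite !Rabs_mult.
    replace (e * (Rabs K * _)) with (Rabs K * (e * Rabs (PSeries (evc p) (z ^ 2)))) by ring.
    apply Rmult_le_compat_l; [apply Rabs_pos|exact HZ].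
Qed.

Lemma pcfD_decay (e : R) : 0 < e ->
  exists Z, forall z, Z <= z -> pcfD nu z ^ 2 + pcfD' nu z ^ 2 <= e.
Proof.
  intros He.
  (* For z >= 4 + |nu| one has z ^ 2 / 4 >= 4 + 2 |nu|, so the potential is at least 1. *)
  apply (subdominant_decay (fun z => z ^ 2 / 4 - nu - / 2) (pcfD nu) (pcfD' nu) (4 + Rabs nu))
    with (weber nu (pcfD0 nu) 0) (weber' nu (pcfD0 nu) 0).
  - apply pcfD_is_derive.
  - apply pcfD'_is_derive.
  - intros z Hz. generalize (Rle_abs nu) (Rabs_pos nu); intros. nra.
  - intros z. now apply weber_is_derive.
  - intros z. now apply weber'_is_derive.
  - apply pcfD_subdominant.
  - exact He.
Qed.

End PCF.

(** * Wronskian of two parabolic cylinder functions *)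

Definition pcf_wronskian (mu nu z : R) : R :=
  pcfD mu z * pcfD' nu z - pcfD nu z * pcfD' mu z.

Section Orthogonality.

Variables mu nu : R.
Hypothesis Hmu : forall n, mu <> INR n.
Hypothesis Hnu : forall n, nu <> INR n.

Lemma pcf_wronskian_is_derive (z : R) :
  is_derive (pcf_wronskian mu nu) z ((mu - nu) * (pcfD mu z * pcfD nu z)).
Proof.
  assert (H1 : is_derive (fun x : R => pcfD mu x) z (pcfD' mu z)) by now apply pcfD_is_derive.
  assert (H2 : is_derive (fun x : R => pcfD nu x) z (pcfD' nu z)) by now apply pcfD_is_derive.
  assert (H3 := pcfD'_is_derive mu Hmu z). assert (H4 := pcfD'_is_derive nu Hnu z).
  unfold pcf_wronskian. auto_derive.
  - repeat split; eexists; eassumption.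
  - rewrite (is_derive_unique _ _ _ H1), (is_derive_unique _ _ _ H2).
    change (fun x : R => pcfD' mu x) with (pcfD' mu).
    change (fun x : R => pcfD' nu x) with (pcfD' nu).
    rewrite (is_derive_unique _ _ _ H3), (is_derive_unique _ _ _ H4). ring.
Qed.

(** Inverting the Gamma condition gives an equality of products of [rgamma], and the Wronskian at 0
    is a multiple of the difference of these products: the powers of 2 in both terms agree. *)
Lemma pcf_wronskian_at_0 :
  Gamma (- nu / 2) * Gamma ((1 - mu) / 2) = Gamma (- mu / 2) * Gamma ((1 - nu) / 2) ->
  pcf_wronskian mu nu 0 = 0.
Proof.
  unfold Gamma. rewrite <- !Rinv_mult. intros H.
  apply (f_equal Rinv) in H. rewrite !Rinv_inv in H.
  unfold pcf_wronskian. rewrite !pcfD_at_0, !pcfD'_at_0 by assumption.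
  unfold pcfD0, pcfD1, Rminus. rewrite !Rpower_plus.
  assert (forall x, Rpower 2 x <> 0) by (intros; apply Rgt_not_eq, exp_pos).
  set (c := sqrt PI * sqrt PI / (Rpower 2 (- mu / 2) * Rpower 2 (- nu / 2) * Rpower 2 (- / 2))).
  transitivity (c * (rgamma (- mu / 2) * rgamma ((1 + - nu) / 2)
                     - rgamma (- nu / 2) * rgamma ((1 + - mu) / 2))).
  - unfold c. field. auto.
  - unfold Rminus in H. rewrite H. ring.
Qed.

(** Each product is at most half the sum of the squares of its factors, which [pcfD_decay]
    controls. *)
Lemma pcf_wronskian_decay (e : R) : 0 < e ->
  exists Z, forall z, Z <= z -> Rabs (pcf_wronskian mu nu z) <= e.
Proof.
  intros He.
  destruct (pcfD_decay mu Hmu (e / 2) ltac:(lra)) as [Z1 H1].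
  destruct (pcfD_decay nu Hnu (e / 2) ltac:(lra)) as [Z2 H2].
  exists (Rmax Z1 Z2). intros z Hz.
  specialize (H1 z (Rle_trans _ _ _ (Rmax_l _ _) Hz)).
  specialize (H2 z (Rle_trans _ _ _ (Rmax_r _ _) Hz)).
  unfold pcf_wronskian.
  generalize (pow2_ge_0 (pcfD mu z - pcfD' nu z)) (pow2_ge_0 (pcfD mu z + pcfD' nu z))
    (pow2_ge_0 (pcfD nu z - pcfD' mu z)) (pow2_ge_0 (pcfD nu z + pcfD' mu z)); intros.
  apply Rabs_le_between. split; lra.
Qed.

End Orthogonality.

(** * Weighted products and the improper integral *)

Lemma pcfH_mul_weight (mu nu x t : R) : 0 < t ->
  pcfH mu x t * pcfH nu x t * exp (- x ^ 2 / (2 * t))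
  = Rpower t (mu / 2) * Rpower t (nu / 2) * (pcfD mu (x / sqrt t) * pcfD nu (x / sqrt t)).
Proof.
  intros Ht. unfold pcfH.
  replace (- x ^ 2 / (2 * t)) with (- (x ^ 2 / (4 * t) + x ^ 2 / (4 * t))) by (field; lra).
  rewrite exp_Ropp, exp_plus. field. apply Rgt_not_eq, exp_pos.
Qed.

(** The fundamental theorem of calculus on [a, y], followed by y tending to infinity with the lower
    end held at a. *)
Lemma is_RInt_gen_of_primitive (f F : R -> R) (a l : R) :
  (forall x, is_derive F x (f x)) -> (forall x, continuous f x) ->
  is_lim F p_infty l ->
  is_RInt_gen f (at_point a) (Rbar_locally p_infty) (l - F a).
Proof.
  intros HF Hf Hl P HP.
  assert (Hlim : filterlim (fun x => F x - F a) (Rbar_locally p_infty) (locally (l - F a))).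
  { apply (is_lim_minus' F (fun _ => F a) p_infty l (F a)); [exact Hl|apply is_lim_const]. }
  apply (Filter_prod _ _ _ (fun x => x = a) (fun x => P (F x - F a))).
  - reflexivity.
  - exact (Hlim P HP).
  - intros x y -> Hy. exists (F y - F a). split; [|exact Hy].
    apply (is_RInt_derive F f a y); intros; auto.
Qed.

Theorem theorem1 (t : R) (alpha : nat -> R) :
  0 < t ->
  (forall (k n : nat), alpha k <> INR n) ->
  (forall k m : nat, alpha k <> alpha m ->
     Gamma (- alpha m / 2) * Gamma ((1 - alpha k) / 2)
     = Gamma (- alpha k / 2) * Gamma ((1 - alpha m) / 2)) ->
  forall k m : nat, alpha k <> alpha m ->
    is_RInt_gen
      (fun x => pcfH (alpha k) x t * pcfH (alpha m) x t * exp (- x ^ 2 / (2 * t)))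
      (at_point 0) (Rbar_locally p_infty) 0.
Proof.
  intros Ht Hal HG k m Hkm.
  assert (Hst : 0 < sqrt t) by now apply sqrt_lt_R0.
  assert (Hk := Hal k). assert (Hm := Hal m). specialize (HG k m Hkm).
  set (mu := alpha k) in *. set (nu := alpha m) in *.
  set (c := Rpower t (mu / 2) * Rpower t (nu / 2)).
  (* The chain rule for x / sqrt t costs 1 / sqrt t and the Wronskian has derivative (mu - nu) D_mu
     D_nu; [C] compensates both. *)
  set (C := c * sqrt t / (mu - nu)).
  set (F := fun x => C * pcf_wronskian mu nu (x / sqrt t)).
  set (f := fun x => pcfH mu x t * pcfH nu x t * exp (- x ^ 2 / (2 * t))).
  assert (Ef : forall x, f x = c * (pcfD mu (x / sqrt t) * pcfD nu (x / sqrt t))).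
  { intros x. now apply pcfH_mul_weight. }
  assert (F0 : F 0 = 0).
  { unfold F, Rdiv. rewrite Rmult_0_l, pcf_wronskian_at_0 by assumption. ring. }
  replace 0 with (0 - F 0) at 2 by (rewrite F0; ring).
  apply is_RInt_gen_of_primitive.
  - intros x. rewrite Ef. unfold F.
    assert (HW : is_derive (fun x : R => pcf_wronskian mu nu x) (x / sqrt t)
      ((mu - nu) * (pcfD mu (x / sqrt t) * pcfD nu (x / sqrt t))))
      by now apply pcf_wronskian_is_derive.
    auto_derive.
    + eexists; exact HW.
    + change (x * / sqrt t) with (x / sqrt t).
      rewrite (is_derive_unique _ _ _ HW). unfold C. field. split; lra.
  - intros x. apply continuous_ext with
      (fun x => c * (pcfD mu (x / sqrt t) * pcfD nu (x / sqrt t))).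
    { intros z; now rewrite Ef. }
    apply (ex_derive_continuous (V := R_NormedModule)).
    assert (H1 : ex_derive (fun x : R => pcfD mu x) (x / sqrt t))
      by (eexists; now apply pcfD_is_derive).
    assert (H2 : ex_derive (fun x : R => pcfD nu x) (x / sqrt t))
      by (eexists; now apply pcfD_is_derive).
    auto_derive. now split.
  - apply is_lim_spec. intros e. simpl.
    (* The added 1 makes the divisor positive without inspecting [C]. *)
    assert (HC : 0 < Rabs C + 1) by (generalize (Rabs_pos C); lra).
    destruct (pcf_wronskian_decay mu nu Hk Hm (e / 2 / (Rabs C + 1))) as [Z HZ].
    { apply Rdiv_lt_0_compat; [generalize (cond_pos e); lra|exact HC]. }
    exists (Z * sqrt t). intros x Hx.
    rewrite Rminus_0_r. unfold F. rewrite Rabs_mult.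
    assert (Hxt : Z <= x / sqrt t).
    { left. apply Rmult_lt_reg_r with (sqrt t); [exact Hst|].
      replace (x / sqrt t * sqrt t) with x by (field; lra). exact Hx. }
    specialize (HZ _ Hxt).
    apply Rle_lt_trans with ((Rabs C + 1) * (e / 2 / (Rabs C + 1))).
    + apply Rmult_le_compat; try apply Rabs_pos; [lra|exact HZ].
    + replace ((Rabs C + 1) * (e / 2 / (Rabs C + 1))) with (e / 2) by (field; lra).
      generalize (cond_pos e); lra.
Qed.
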